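(* Let $R$ be a commutative ring with unity and let $\Gamma = \Gamma_2(R)$. Then there is a generating set $S$ of $\Gamma$, which is finite when $R$ is finite, such that, with respect to the word length on $\Gamma$ determined by $S$, the conjugacy length function of $\Gamma$ satisfies $$\mathrm{CLF}_\Gamma(n) \leq 3n \quad \text{for all } n\in[0,\infty).$$
   Context: For a commutative ring $R$ with unity, $\Gamma_2(R)$ denotes the group $R[t,t^{-1}]\rtimes \mathbb{Z}$, where $\mathbb{Z}$ acts on the additive group of Laurent polynomials $R[t,t^{-1}]$ by multiplication by $t$. Its elements are written as pairs $(P,k)$ with $P\in R[t,t^{-1}]$, $k\in\mathbb{Z}$, with multiplication $(P,k)(Q,l)=(P+t^kQ,\,k+l)$; equivalently $(P,k)$ is the matrix $\begin{pmatrix} t^k & P\\ 0&1\end{pmatrix}$. (For instance $\Gamma_2(\mathbb{Z}_q)=\mathbb{Z}_q\wr\mathbb{Z}$ and $\Gamma_2(\mathbb{Z})=\mathbb{Z}\wr\mathbb{Z}$.) Given a group $\Gamma$ with a length function $|\cdot|:\Gamma\to[0,\infty)$, the conjugacy length function is the minimal function $\mathrm{CLF}_\Gamma:[0,\infty)\to[0,\infty)$ satisfying: if $u$ is conjugate to $v$ in $\Gamma$ and $|u|+|v|\leq n$, then there exists a conjugator $\gamma\in\Gamma$ (that is, $\gamma u=v\gamma$) such that $|\gamma|\leq \mathrm{CLF}_\Gamma(n)$. The word length of $g$ with respect to a generating set $S$ (possibly infinite) is the least length of a word in $S\cup S^{-1}$ representing $g$. *)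

(* Defs.v *)
From HB Require Import structures.
From mathcomp Require Import all_boot all_order all_algebra finmap.
From mathcomp Require Import boolp classical_sets cardinality reals.
From mathcomp Require Import interval_inference monalg.

Set Implicit Arguments.
Unset Strict Implicit.
Unset Printing Implicit Defensive.

Import Order.TTheory GRing.Theory Num.Theory.

Local Open Scope ring_scope.

(* The ring R[t, t^-1], as finitely supported functions int -> R under
   convolution.  The ring structure that monalg puts on {malg R[K]} is not
   available here: its monomials form a monoid without nontrivial units, and
   its R is nonzero. *)
Definition laurent (R : comPzRingType) := {malg R[int]}.

HB.instance Definition _ (R : comPzRingType) := GRing.Zmodule.on (laurent R).

Section LaurentRing.
Variable R : comPzRingType.
Implicit Types (P Q : laurent R) (k l : int).

Definition tpow k : laurent R := << 1 *g k >>.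

Definition laurent_mul P Q : laurent R :=
  \sum_(i <- msupp P) \sum_(j <- msupp Q) << P@_i * Q@_j *g i + j >>.

Lemma laurent_mulw (d e : {fset int}) P Q :
  (msupp P `<=` d)%fset -> (msupp Q `<=` e)%fset ->
  laurent_mul P Q = \sum_(i <- d) \sum_(j <- e) << P@_i * Q@_j *g i + j >>.
Proof.
move=> le_d le_e; rewrite /laurent_mul (big_fset_incl _ le_d) /=.
  apply/eq_bigr=> i _; apply/big_fset_incl => // k _ /mcoeff_outdom ->.
  by rewrite mulr0 monalgU0.
move=> k _ /mcoeff_outdom Pk.
by rewrite big1 => // j _; rewrite Pk mul0r monalgU0.
Qed.

Lemma laurent_mulC : commutative laurent_mul.
Proof.
move=> P Q; rewrite /laurent_mul exchange_big; apply/eq_bigr=> j _.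
by apply/eq_bigr=> i _; rewrite mulrC addrC.
Qed.

Lemma laurent_mul0 P : laurent_mul 0 P = 0.
Proof. by rewrite /laurent_mul msupp0 big_seq_fset0. Qed.

Lemma laurent_mulDl : left_distributive laurent_mul +%R.
Proof.
move=> P1 P2 Q; have sQ := fsubset_refl (msupp Q).
rewrite [in RHS](laurent_mulw (fsubsetUl (msupp P1) (msupp P2)) sQ).
rewrite [in RHS](laurent_mulw (fsubsetUr (msupp P1) (msupp P2)) sQ).
rewrite (laurent_mulw (msuppD_le _ _) sQ) -big_split /=.
apply/eq_bigr=> i _; rewrite -big_split /=; apply/eq_bigr=> j _.
by rewrite mcoeffD mulrDl monalgUD.
Qed.

Lemma laurent_mulDr : right_distributive laurent_mul +%R.
Proof.
by move=> P Q1 Q2; rewrite laurent_mulC laurent_mulDl !(laurent_mulC P).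
Qed.

Lemma laurent_mulUU (a b : R) k l :
  laurent_mul << a *g k >> << b *g l >> = << a * b *g k + l >>.
Proof.
by rewrite (laurent_mulw msuppU_le msuppU_le) !big_seq_fset1 !mcoeffUU.
Qed.

Lemma laurent_mul1 : left_id (tpow 0) laurent_mul.
Proof.
move=> P; rewrite (laurent_mulw msuppU_le (fsubset_refl _)) big_seq_fset1.
rewrite [RHS]monalgE; apply/eq_bigr=> j _.
by rewrite mcoeffUU mul1r add0r.
Qed.

Lemma laurent_mulA : associative laurent_mul.
Proof.
have mul0 P : laurent_mul P 0 = 0 by rewrite laurent_mulC laurent_mul0.
have sumL P : {morph laurent_mul^~ P : x y / x + y}.
  by move=> *; apply: laurent_mulDl.
have sumR P : {morph laurent_mul P : x y / x + y}.
  by move=> *; apply: laurent_mulDr.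
have mulL I (r : seq I) F P :
    laurent_mul (\sum_(i <- r) F i) P = \sum_(i <- r) laurent_mul (F i) P.
  exact: (big_morph _ (sumL P) (laurent_mul0 P)).
have mulR I (r : seq I) F P :
    laurent_mul P (\sum_(i <- r) F i) = \sum_(i <- r) laurent_mul P (F i).
  exact: (big_morph _ (sumR P) (mul0 P)).
have mulA_U i j k (a b c : R) :
    laurent_mul << a *g i >> (laurent_mul << b *g j >> << c *g k >>) =
    laurent_mul (laurent_mul << a *g i >> << b *g j >>) << c *g k >>.
  by rewrite !laurent_mulUU mulrA addrA.
move=> P Q S; pose u (T : laurent R) i : laurent R := << T@_i *g i >>.
have uE T : T = \sum_(i <- msupp T) u T i by exact: monalgE.
rewrite (uE P); move: (msupp P) => p; rewrite (uE Q); move: (msupp Q) => q.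
rewrite (uE S); move: (msupp S) => s.
rewrite (mulL _ p) (mulL _ p) (mulL _ p); apply/eq_bigr=> i _.
rewrite (mulL _ q) (mulR _ q) (mulR _ q) (mulL _ q); apply/eq_bigr=> j _.
by rewrite !(mulR _ s); apply/eq_bigr=> k _; apply: mulA_U.
Qed.

HB.instance Definition _ := GRing.Zmodule_isComPzRing.Build (laurent R)
  laurent_mulA laurent_mulC laurent_mul1 laurent_mulDl.

Lemma tpow0 : tpow 0 = 1. Proof. by []. Qed.

Lemma tpowD k l : tpow (k + l) = tpow k * tpow l.
Proof. by rewrite [RHS]laurent_mulUU mulr1. Qed.

Lemma mcoeff_tpowM k P n : (tpow k * P)@_n = P@_(n - k).
Proof.
rewrite [P in LHS]monalgE mulr_sumr !raddf_sum /= [P in RHS]monalgE raddf_sum.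
apply/eq_bigr=> j _; rewrite [tpow k * _]laurent_mulUU mul1r !mcoeffU.
by rewrite [RHS]mcoeffU eq_sym [in RHS]eq_sym subr_eq (addrC k).
Qed.

End LaurentRing.

Definition Gamma2 (R : comPzRingType) : Type := (laurent R * int)%type.

HB.instance Definition _ (R : comPzRingType) := Choice.on (Gamma2 R).

Section Gamma2Group.
Variable R : comPzRingType.
Implicit Types x y z : Gamma2 R.

Definition Gamma2_one : Gamma2 R := (0, 0).
Definition Gamma2_mul x y : Gamma2 R := (x.1 + tpow R x.2 * y.1, x.2 + y.2).
Definition Gamma2_inv x : Gamma2 R := (- (tpow R (- x.2) * x.1), - x.2).

Lemma Gamma2_mulA : associative Gamma2_mul.
Proof.
move=> x y z; rewrite /Gamma2_mul /=.
by rewrite mulrDr tpowD !addrA mulrA.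
Qed.

Lemma Gamma2_mul1g : left_id Gamma2_one Gamma2_mul.
Proof. by case=> P k; rewrite /Gamma2_mul /= tpow0 mul1r !add0r. Qed.

Lemma Gamma2_mulg1 : right_id Gamma2_one Gamma2_mul.
Proof. by case=> P k; rewrite /Gamma2_mul /= mulr0 !addr0. Qed.

Lemma Gamma2_mulVg : left_inverse Gamma2_one Gamma2_inv Gamma2_mul.
Proof. by case=> P k; rewrite /Gamma2_mul /= !addNr. Qed.

Lemma Gamma2_mulgV : right_inverse Gamma2_one Gamma2_inv Gamma2_mul.
Proof.
case=> P k; rewrite /Gamma2_mul /= mulrN mulrA -tpowD subrr tpow0 mul1r.
by rewrite subrr.
Qed.

HB.instance Definition _ := isGroup.Build (Gamma2 R)
  Gamma2_mulA Gamma2_mul1g Gamma2_mulg1 Gamma2_mulVg Gamma2_mulgV.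

End Gamma2Group.

Section WordLength.
Variables (G : groupType) (S : set G).
Local Open Scope group_scope.

Definition is_word (w : seq G) : Prop :=
  forall x, x \in w -> S x \/ S x^-1.

Definition represents (w : seq G) (g : G) : Prop := \prod_(x <- w) x = g.

Definition generates : Prop :=
  forall g : G, exists w : seq G, is_word w /\ represents w g.

Definition has_word (g : G) (n : nat) : Prop :=
  exists w : seq G, [/\ is_word w, represents w g & size w = n].

(* Junk value 0 on elements outside the subgroup generated by S. *)
Definition word_length (g : G) : nat :=
  if pselect (exists n, `[< has_word g n >]) is left ex then ex_minn ex else 0%N.

End WordLength.

Section ConjugacyLength.
Variables (K : realType) (G : groupType) (len : G -> {nonneg K}).

Definition conjugate (u v : G) : Prop := exists g : G, (g * u = v * g)%g.

Definition bounds_conjugators (f : {nonneg K} -> {nonneg K}) : Prop :=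
  forall (n : {nonneg K}) (u v : G), conjugate u v ->
    (len u)%:num + (len v)%:num <= n%:num ->
    exists g : G, (g * u = v * g)%g /\ (len g)%:num <= (f n)%:num.

Definition is_CLF (f : {nonneg K} -> {nonneg K}) : Prop :=
  bounds_conjugators f /\
  forall f', bounds_conjugators f' -> forall n, (f n)%:num <= (f' n)%:num.

End ConjugacyLength.

Definition word_norm (K : realType) (G : groupType) (S : set G) (g : G) :
  {nonneg K} := (word_length S g)%:R%:nng.

(* Main.v *)
Require Import Defs.
From mathcomp Require Import all_boot all_order all_algebra.
From mathcomp Require Import classical_sets cardinality reals interval_inference.
From mathcomp Require Import finmap boolp monalg zify.

Set Implicit Arguments.
Unset Strict Implicit.
Unset Printing Implicit Defensive.

(** Take S = {(r, 1) | r in R}.  Think of an element (P, k) as a walker on the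
    integers, standing at k, who started at 0 and has written the coefficient
    P@_i on the edge from i to i + 1.  Right multiplication by (r, 1) moves him
    one step forward and adds r to the edge he crosses; its inverse moves him
    one step back and subtracts r from the edge he crosses.  Each crossing can
    therefore rewrite an edge at will, and word length is governed by geometry
    alone: if [a, b] is an interval containing 0, k and all the edges on which
    P is nonzero ([spans]), then (P, k) can be written with 2 (b - a) - k
    letters ([spans_word]), while a word of length n determines
    such an interval with b - a <= n ([word_spans]).

    Let u = (P, k) and v = (Q, k) be conjugate, with intervals [a1, b1] and
    [a2, b2].  A conjugator (A, l) is a solution of
      A + t^l P = Q + t^k A.
    Up to inverting u and v, which changes neither the conjugators nor the
    lengths of the intervals, either k = 0 or k > 0.

    If k = 0 then Q = t^l P, so (0, l) is also a conjugator; unless P = 0, when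
    u = v, the shift by l takes an edge of [a1, b1] to an edge of [a2, b2], and
    since both intervals contain 0 this forces |l| <= (b1 - a1) + (b2 - a2)
    ([short_conj_zero]).

    If k > 0, multiplying the conjugator by a power of u reduces l modulo k, so
    0 <= l < k.  Outside the supports of t^l P and Q the equation says that A is
    k-periodic; being finitely supported, A vanishes there, and its support is
    at least k shorter than the union of those two ([supp_quotient],
    [conj_support]).  The resulting interval for (A, l) gives a word of length
    at most 2 ((b1 - a1) + (b2 - a2)) ([short_conj_pos]).

    In both cases the conjugator has length at most 2 (|u| + |v|).  Since word
    length takes integer values, the least admissible bound at each n is
    attained, so that the conjugacy length function exists ([CLF_le]). *)

Import Order.TTheory GRing.Theory Num.Theory.

Local Open Scope classical_set_scope.
Local Open Scope ring_scope.

(** * Word length and conjugacy length in a group *)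

Section Words.
Variables (G : groupType) (S : set G).

Lemma has_word1 : has_word S 1%g 0.
Proof. by exists [::]; split=> //; rewrite /represents big_nil. Qed.

Lemma has_word_gen s : S s -> has_word S s 1.
Proof.
move=> Ss; exists [:: s]; split=> //; last by rewrite /represents big_seq1.
by move=> x; rewrite inE => /eqP->; left.
Qed.

Lemma has_word_genV s : S s -> has_word S s^-1%g 1.
Proof.
move=> Ss; exists [:: s^-1%g]; split=> //; last by rewrite /represents big_seq1.
by move=> x; rewrite inE => /eqP->; right; rewrite invgK.
Qed.

Lemma has_wordM g h m n :
  has_word S g m -> has_word S h n -> has_word S (g * h)%g (m + n).
Proof.
move=> [w [Ww Pw <-]] [z [Wz Pz <-]]; exists (w ++ z); split.
- by move=> x; rewrite mem_cat => /orP[/Ww|/Wz].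
- by rewrite /represents big_cat Pw Pz.
- by rewrite size_cat.
Qed.

Lemma word_length_le g n : has_word S g n -> (word_length S g <= n)%N.
Proof.
move=> gn; rewrite /word_length; case: pselect => // ex.
by case: ex_minnP => m _; apply; apply/asboolP.
Qed.

Lemma word_length_word : generates S ->
  forall g, has_word S g (word_length S g).
Proof.
move=> gen g; rewrite /word_length; case: pselect => [ex|[]].
  by case: ex_minnP => m /asboolP.
by have [w [Ww Pw]] := gen g; exists (size w); apply/asboolP; exists w.
Qed.

Lemma has_word_generates :
  (forall g, exists n, has_word S g n) -> generates S.
Proof. by move=> ex g; have [n [w [? ? _]]] := ex g; exists w. Qed.

(** The conjugacy length function at n is the least natural number that bounds
    some conjugator of every conjugate pair of total length at most n.  It is
    minimal among real-valued bounds too, because a real bound on an integer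
    can be replaced by its integer part. *)
Lemma CLF_le (K : realType) (c : nat) :
  (forall u v : G, conjugate u v -> exists g : G, (g * u = v * g)%g /\
     (word_length S g <= c * (word_length S u + word_length S v))%N) ->
  exists CLF : {nonneg K} -> {nonneg K},
    is_CLF (word_norm K S) CLF /\
    forall n : {nonneg K}, (CLF n)%:num <= c%:R * n%:num.
Proof.
move=> short.
pose bounds (n : {nonneg K}) (m : nat) := forall u v : G, conjugate u v ->
  (word_norm K S u)%:num + (word_norm K S v)%:num <= n%:num ->
  exists g : G, (g * u = v * g)%g /\ (word_length S g <= m)%N.
have bounds_trunc n : bounds n (c * Num.truncn n%:num)%N.
  move=> u v /short[g [gu le_g]]; rewrite /= -natrD => le_n.
  exists g; split=> //; apply: leq_trans le_g _.
  by rewrite leq_mul2l truncn_ge_nat ?le_n ?orbT.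
have ex n : exists m, `[< bounds n m >].
  by exists (c * Num.truncn n%:num)%N; apply/asboolP.
exists (fun n => (ex_minn (ex n))%:R%:nng); split; first split.
- move=> n u v uv le_n; case: ex_minnP => m + _.
  move=> /asboolP/(_ u v uv le_n)[g [gu gm]].
  by exists g; split=> //=; rewrite ler_nat.
- move=> f bf n /=; case: ex_minnP => m _ min_m.
  rewrite -truncn_ge_nat //; apply: min_m; apply/asboolP => u v uv le_n.
  have [g [gu le_g]] := bf n u v uv le_n; exists g; split=> //.
  by rewrite truncn_ge_nat.
- move=> n /=; case: ex_minnP => m _ /(_ (c * Num.truncn n%:num)%N) min_m.
  have /min_m le_m : `[< bounds n (c * Num.truncn n%:num)%N >] by apply/asboolP.
  apply: (@le_trans _ _ (c * Num.truncn n%:num)%N%:R); first by rewrite ler_nat.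
  by rewrite natrM ler_wpM2l // truncn_le.
Qed.

End Words.

(** * Word length in Gamma2 as the geometry of a walk *)

Section Gamma2.
Variable R : comPzRingType.
Implicit Types (P Q A : laurent R) (g h u v : Gamma2 R) (a b i k l : int).

Definition letter (r : R) : Gamma2 R := (<< r *g 0 >>, 1).
Definition letters : set (Gamma2 R) := range letter.

Lemma Gamma2_mulE g h : (g * h)%g = (g.1 + tpow R g.2 * h.1, g.2 + h.2).
Proof. by []. Qed.

Lemma conj_coords g u v : (g * u = v * g)%g ->
  g.1 + tpow R g.2 * u.1 = v.1 + tpow R v.2 * g.1 /\ v.2 = u.2.
Proof.
rewrite !Gamma2_mulE => e; split; first exact: (congr1 fst e).
by have /= := congr1 snd e; lia.
Qed.

Lemma Gamma2_invE g : (g^-1)%g = (- (tpow R (- g.2) * g.1), - g.2).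
Proof. by []. Qed.

(** The walker's range: [a, b] contains the start 0, the end k = g.2, and every
    edge [i, i + 1] that carries a nonzero coefficient. *)
Definition spans g a b :=
  [/\ a <= 0 <= b, a <= g.2 <= b & forall i, g.1@_i != 0 -> a <= i < b].

Lemma spansV {g a b} : spans g a b -> spans g^-1%g (a - g.2) (b - g.2).
Proof.
move=> [ab0 abg sg]; rewrite Gamma2_invE; split=> /=; [lia|lia|].
by move=> i; rewrite mcoeffN mcoeff_tpowM opprK oppr_eq0 => /sg; lia.
Qed.

(** Putting a letter in front of a word shifts the rest of the walk by one step
    forward and adds the edge from 0 to 1.  The left end moves with the walk
    except when it is 0, as the interval must still contain the new start. *)
Lemma spans_letterM r g a b : spans g a b ->
  exists a' b', spans (letter r * g)%g a' b' /\ b' - a' <= b - a + 1.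
Proof.
move=> [ab0 abg sg]; exists (if a == 0 then 0 else a + 1), (b + 1).
split; last by case: eqP; lia.
rewrite Gamma2_mulE; split=> /=; [by case: eqP; lia..|].
move=> i; rewrite mcoeffD mcoeff_tpowM mcoeffU.
have [->|gi] := eqVneq g.1@_(i - 1) 0; last first.
  by have := sg _ gi; case: (a =P 0); lia.
case: (0 =P i) => [<- _|_]; first by case: (a =P 0); lia.
by rewrite mulr0n addr0 eqxx.
Qed.

Lemma spans_letterVM r g a b : spans g a b ->
  exists a' b', spans ((letter r)^-1 * g)%g a' b' /\ b' - a' <= b - a + 1.
Proof.
move=> [ab0 abg sg]; exists (a - 1), (if b == 0 then 0 else b - 1).
split; last by case: eqP; lia.
rewrite Gamma2_mulE Gamma2_invE; split=> /=; [by case: eqP; lia..|].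
move=> i; rewrite mcoeffD mcoeffN !mcoeff_tpowM mcoeffU opprK.
have [->|gi] := eqVneq g.1@_(i + 1) 0; last first.
  by have := sg _ gi; case: (b =P 0); lia.
case: (0 =P i + 1) => [i0 _|_]; first by case: (b =P 0); lia.
by rewrite mulr0n oppr0 addr0 eqxx.
Qed.

(** A walk of n steps visits an interval of length at most n. *)
Lemma word_spans {g n} : has_word letters g n ->
  exists a b, spans g a b /\ b - a <= n%:Z.
Proof.
case=> w [Ww <- <-]; elim: w Ww => [_|x w IHw Ww].
  exists 0, 0; rewrite /represents big_nil; split=> //; split=> // i.
  by rewrite mcoeff0 eqxx.
have [|a [b [sab ab]]] := IHw.
  by move=> y yw; apply: Ww; rewrite inE yw orbT.
rewrite big_cons.
have [[r _ <-]|[r _ xE]] := Ww x (mem_head _ _).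
  have [a' [b' [s' le']]] := spans_letterM r sab.
  by exists a', b'; split=> //; rewrite (le_trans le') // intS addrC lerD2l.
rewrite -(invgK x) -xE.
have [a' [b' [s' le']]] := spans_letterVM r sab.
by exists a', b'; split=> //; rewrite (le_trans le') // intS addrC lerD2l.
Qed.

Lemma mcoeff_bounded P : exists n : nat, forall i, P@_i != 0 -> (absz i < n)%N.
Proof.
exists (\max_(i <- msupp P) absz i).+1 => i Pi; rewrite ltnS.
by apply: (@leq_bigmax_seq _ _ _ absz) => //; rewrite -mcoeff_neq0.
Qed.

Lemma ex_spans g : exists a b, spans g a b.
Proof.
have [n bn] := mcoeff_bounded g.1.
exists (- (n + absz g.2)%:Z), (n + absz g.2)%:Z.
by split; [lia..|move=> i /bn; lia].
Qed.

Lemma has_word_tpow l : has_word letters (0, l) (absz l).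
Proof.
have word1 : letters (0, 1) by exists 0; rewrite // /letter monalgU0.
case: l => n /=.
  elim: n => [|n IHn]; first exact: has_word1.
  have := has_wordM (has_word_gen (S := letters) word1) IHn.
  by rewrite Gamma2_mulE /= mulr0 addr0.
elim: n => [|n IHn].
  have := has_word_genV (S := letters) word1.
  by rewrite Gamma2_invE /= mulr0 oppr0.
have := has_wordM (has_word_genV (S := letters) word1) IHn.
rewrite Gamma2_mulE Gamma2_invE /= !mulr0 oppr0 addr0.
by have -> : -1 + Negz n = Negz n.+1 by lia.
Qed.

(** Walking forward once from 0 to n suffices to write any polynomial of degree
    less than n. *)
Lemma has_word_poly (c : nat -> R) n :
  has_word letters (\sum_(i < n) << c i *g i%:Z >>, n%:Z) n.
Proof.
elim: n => [|n IHn]; first by rewrite big_ord0; apply: has_word1.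
have cn : letters (letter (c n)) by exists (c n).
have := has_wordM IHn (has_word_gen (S := letters) cn).
rewrite Gamma2_mulE addn1 /= big_ord_recr /= => hw.
have e : tpow R n%:Z * << c n *g 0 >> = << c n *g n%:Z >>.
  by rewrite [LHS]laurent_mulUU mul1r addr0.
by rewrite e in hw; have -> : n.+1%:Z = n%:Z + 1 by lia.
Qed.

(** Walk from 0 to a without writing, then forward to b while writing all the
    coefficients, then from b to the final position without writing. *)
Lemma spans_word {g a b} : spans g a b ->
  has_word letters g (absz a + absz (b - a)%R + absz (g.2 - b)%R)%N.
Proof.
move=> [ab0 abg sg].
have := has_wordM (has_wordM (has_word_tpow a)
  (has_word_poly (fun n => g.1@_(a + n%:Z)) (absz (b - a)%R)))
  (has_word_tpow (g.2 - b)).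
rewrite !Gamma2_mulE /= mulr0 addr0 add0r.
set P := _ * _; suff -> : P = g.1.
  have -> : a + `|(b - a)%R|%N%:Z + (g.2 - b) = g.2 by lia.
  by rewrite -surjective_pairing.
apply/malgP => i; rewrite mcoeff_tpowM raddf_sum /=.
have [iab|iNab] := boolP (a <= i < b); last first.
  have -> : g.1@_i = 0 by apply/eqP/negPn/negP => /sg; lia.
  apply: big1 => j _; rewrite mcoeffU; case: eqP => // ji.
  by have := ltn_ord j; lia.
have ib : (absz (i - a)%R < absz (b - a)%R)%N by lia.
rewrite (bigD1 (Ordinal ib)) //= mcoeffU big1 ?addr0.
  have -> : `|(i - a)%R|%N%:Z = i - a by lia.
  by rewrite eqxx mulr1n; congr (mcoeff _ _); lia.
move=> j /eqP ji; rewrite mcoeffU; case: eqP => // e; case: ji.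
by apply: val_inj => /=; lia.
Qed.

Lemma generates_letters : generates letters.
Proof.
apply: has_word_generates => g; have [a [b /spans_word gw]] := ex_spans g.
by exists (absz a + absz (b - a)%R + absz (g.2 - b)%R)%N.
Qed.

Lemma finite_letters : finite_set [set: R] -> finite_set letters.
Proof. exact: finite_image. Qed.

(** * Short conjugators *)

(** This bounds the support of a quotient by t^k - 1: a finitely supported A is
    determined by (t^k - 1) A, since to the left of a and to the right of b - k
    it is k-periodic, hence equal to its values far away. *)
Lemma supp_quotient A (k a b : int) : 0 < k ->
  (forall i, A@_(i - k) != A@_i -> a <= i < b) ->
  forall i, A@_i != 0 -> a <= i < b - k.
Proof.
move=> k0 D; have [N bN] := mcoeff_bounded A.
have down n i : i < a -> A@_(i - k * n%:Z) = A@_i.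
  move=> ia; elim: n => [|n <-]; first by rewrite mulr0 subr0.
  have -> : i - k * n.+1%:Z = i - k * n%:Z - k by lia.
  by apply/eqP/negPn/negP => /D; nia.
have up n i : b - k <= i -> A@_(i + k * n%:Z) = A@_i.
  move=> ib; elim: n => [|n <-]; first by rewrite mulr0 addr0.
  have -> : i + k * n%:Z = i + k * n.+1%:Z - k by lia.
  by apply/esym/eqP/negPn/negP => /D; nia.
move=> i Ai; rewrite !ltNge -[_ && _]negbK negb_and.
apply/negP => /orP[|].
  (* [N + |i|] periods lead out of the support, as [k >= 1] *)
  rewrite -ltNge => /(down (N + absz i)%N) e; move: Ai; rewrite -e => /bN; nia.
rewrite negbK => /(up (N + absz i)%N) e; move: Ai; rewrite -e => /bN; nia.
Qed.

(** The powers of u centralize u, so they may be used to shift the second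
    coordinate of a conjugator by any multiple of u.2. *)
Lemma commute_shift u (j : int) :
  exists c : Gamma2 R, (c * u = u * c)%g /\ c.2 = j * u.2.
Proof.
have pow2 n : (u ^+ n)%g.2 = n%:Z * u.2.
  elim: n => [|n IHn]; first by rewrite mul0r.
  by rewrite expgS Gamma2_mulE /= IHn; lia.
have comm n : commute (u ^+ n)%g u by apply/commute_sym/commuteX.
case: j => n; first by exists (u ^+ n)%g; split; [exact: comm|exact: pow2].
exists (u ^- n.+1)%g; split; last by rewrite Gamma2_invE pow2 NegzE mulNr.
by apply/commute_sym/commuteV/commute_sym/comm.
Qed.

(** A solves (t^k - 1) A = t^l P - Q, whose right-hand side lives on the edges
    between min(a1, a2) and max(b1, b2) + l; dividing by t^k - 1 removes k edges
    on the right.  As b1, b2 >= k, the interval left still reaches l. *)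
Lemma conj_support {g u v a1 b1 a2 b2} : (g * u = v * g)%g ->
  spans u a1 b1 -> spans v a2 b2 -> 0 < u.2 -> 0 <= g.2 ->
  spans g (Num.min a1 a2) (Num.max (b1 - u.2) (b2 - u.2) + g.2).
Proof.
move=> /conj_coords[eP vu] [? ? su] [? ? sv] k0 l0.
split; [lia|lia|].
move=> i Ai.
suff : Num.min a1 a2 <= i < Num.max b1 b2 + g.2 - u.2 by lia.
apply: (supp_quotient k0 _ Ai) => j Dj.
have [uj|uj] := eqVneq u.1@_(j - g.2) 0; last by have := su _ uj; lia.
have [vj|vj] := eqVneq v.1@_j 0; last by have := sv _ vj; lia.
move/(congr1 (mcoeff j)): eP.
rewrite !mcoeffD !mcoeff_tpowM uj vj vu addr0 add0r => e.
by rewrite e eqxx in Dj.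
Qed.

(** Choosing 0 <= l < k keeps the interval of the conjugator within the sum of
    the lengths of the two given ones: its left part costs at most -a1 - a2, its
    right part at most (b1 - k) + (b2 - k) + l, and l < k. *)
Lemma short_conj_pos u v a1 b1 a2 b2 : conjugate u v ->
  spans u a1 b1 -> spans v a2 b2 -> 0 < u.2 ->
  exists g, (g * u = v * g)%g /\
    (word_length letters g)%:Z <= 2 * ((b1 - a1) + (b2 - a2)).
Proof.
move=> [g gu] su sv k0.
have [c [cu c2]] := commute_shift u (- (g.2 %/ u.2)%Z).
pose h : Gamma2 R := (g * c)%g.
have hu : (h * u = v * h)%g by rewrite -mulgA cu mulgA gu mulgA.
have h2 : h.2 = (g.2 %% u.2)%Z.
  by rewrite /h Gamma2_mulE /= c2 {1}(divz_eq g.2 u.2); lia.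
have h0 : 0 <= h.2 < u.2 by rewrite h2 modz_ge0 ?ltz_pmod //; lia.
exists h; split=> //.
have sh := conj_support hu su sv k0 (proj1 (andP h0)).
have := word_length_le (spans_word sh).
by case: su sv => ? ? _ [? ? _]; lia.
Qed.

(** Conjugating (P, 0) by (A, l) gives (t^l P, 0) whatever A is, so the part A
    of the given conjugator may be dropped. *)
Lemma short_conj_zero u v a1 b1 a2 b2 : conjugate u v ->
  spans u a1 b1 -> spans v a2 b2 -> u.2 = 0 ->
  exists g, (g * u = v * g)%g /\
    (word_length letters g)%:Z <= (b1 - a1) + (b2 - a2).
Proof.
move=> [[A l] /conj_coords[/= eP vu]] su sv u0.
have v0 : v.2 = 0 by rewrite vu.
have eQ : v.1 = tpow R l * u.1.
  by move: eP; rewrite v0 tpow0 mul1r addrC => /addIr.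
have [u1|] := eqVneq u.1 0.
  exists 1%g; rewrite mul1g mulg1; split.
    by rewrite (surjective_pairing u) (surjective_pairing v) eQ u1 mulr0 u0 v0.
  move: (word_length_le (has_word1 letters)); rewrite leqn0 => /eqP->.
  by case: su sv => ? ? _ [? ? _]; lia.
move=> u1; have [i ui] : exists i, u.1@_i != 0.
  apply: contrapT => noi; case/eqP: u1; apply/malgP => i; rewrite mcoeff0.
  by apply: contra_notP noi => /eqP; exists i.
exists (0, l); rewrite !Gamma2_mulE; split.
  by rewrite /= eQ v0 u0 mulr0 addr0 !add0r addr0.
(* i and i + l are edges of [a1, b1] and [a2, b2], which both contain 0 *)
have vi : v.1@_(i + l) != 0 by rewrite eQ mcoeff_tpowM addrK.
have := word_length_le (has_word_tpow l).
case: su sv => ? ? /(_ _ ui) ? [? ? /(_ _ vi) ?]; lia.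
Qed.

Lemma short_conj u v : conjugate u v -> exists g, (g * u = v * g)%g /\
  (word_length letters g <=
     2 * (word_length letters u + word_length letters v))%N.
Proof.
move=> uv.
have [a1 [b1 [su le1]]] := word_spans (word_length_word generates_letters u).
have [a2 [b2 [sv le2]]] := word_spans (word_length_word generates_letters v).
have [u0|u0|u0] := ltrgt0P u.2.
- have [g [gu le_g]] := short_conj_pos uv su sv u0.
  by exists g; split=> //; lia.
- (* u and v have the same conjugators as their inverses *)
  have inv (g x y : Gamma2 R) : (g * x = y * g -> g * x^-1 = y^-1 * g)%g.
    by move=> e; apply: (mulgI y); rewrite mulVKg mulgA -e mulgK.
  have uvV : conjugate u^-1%g v^-1%g by have [g gu] := uv; exists g; apply: inv.
  have [|g [gu le_g]] := short_conj_pos uvV (spansV su) (spansV sv).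
    by rewrite Gamma2_invE /=; lia.
  by exists g; split; [rewrite -(invgK u) -(invgK v); apply: inv|lia].
- have [g [gu le_g]] := short_conj_zero uv su sv u0.
  by exists g; split=> //; lia.
Qed.

End Gamma2.

Unset Implicit Arguments.

Theorem theorem1 (R : comPzRingType) (K : realType) :
  exists S : set (Gamma2 R),
    [/\ generates S,
        finite_set [set: R] -> finite_set S
      & exists CLF : {nonneg K} -> {nonneg K},
          is_CLF (word_norm K S) CLF /\
          forall n : {nonneg K}, (CLF n)%:num <= 3 * n%:num].
Proof.
exists (@letters R); split; [exact: generates_letters|exact: finite_letters|].
have [CLF [isCLF le2]] := CLF_le K (@short_conj R).
exists CLF; split=> // n; apply: le_trans (le2 n) _.
by rewrite ler_wpM2r // ler_nat.
Qed.
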